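(* Let $X$ be a Hausdorff topological group with operations and let $G$ be a regular $G$-method for $X$ which preserves the $G$-convergence of subsequences. If $A$ and $B$ are $G$-compact subsets of $X$, then $A\times B$ is a $G$-compact subset of $X\times X$.
   Context: Groups with operations. A category of groups with operations consists of groups (written additively, not necessarily abelian) with a set of operations $\Omega=\Omega_0\cup\Omega_1\cup\Omega_2$ ($\Omega_i$ the $i$-ary operations) and a set of identities including the group laws, such that: $\Omega_0=\{0\}$; $-\in\Omega_1$, $+\in\Omega_2$; with $\Omega_1'=\Omega_1\setminus\{-\}$ and $\Omega_2'=\Omega_2\setminus\{+\}$, if $\star\in\Omega_2'$ then $\star^\circ$, defined by $x\star^\circ y=y\star x$, is in $\Omega_2'$; and for $\star\in\Omega_2'$, $\omega\in\Omega_1'$ the identities $x\star(y+z)=x\star y+x\star z$, $\omega(x+y)=\omega(x)+\omega(y)$, $\omega(x)\star y=\omega(x\star y)$ hold. A morphism of groups with operations is a group homomorphism preserving the operations of $\Omega_1'$ and $\Omega_2'$. A subgroup with operations is a subgroup closed under all operations in $\Omega_1$ and $\Omega_2$. A topological group with operations is such an object with a topology making all operations continuous. $G$-methods. Let $s(X)$ be the set of all sequences in $X$, a group with operations under termwise operations. A $G$-method for $X$ is a morphism of groups with operations $G\colon c_G(X)\to X$ defined on a subgroup with operations $c_G(X)$ of $s(X)$. A sequence $\mathbf{x}$ is $G$-convergent to $\ell$ if $\mathbf{x}\in c_G(X)$ and $G(\mathbf{x})=\ell$; writing $G(\mathbf{x})=\ell$ includes $\mathbf{x}\in c_G(X)$.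 $G$ is regular if every convergent sequence $\mathbf{x}$ in $X$ lies in $c_G(X)$ and $G(\mathbf{x})=\lim\mathbf{x}$. $G$ preserves the $G$-convergence of subsequences if, whenever $G(\mathbf{x})=\ell$, every subsequence of $\mathbf{x}$ is also $G$-convergent to $\ell$. Product. $X\times X$ carries the product topology and componentwise operations, and $G$ is applied to sequences in $X\times X$ componentwise: $(\mathbf{x},\mathbf{y})=((x_n,y_n))$ is $G$-convergent iff $\mathbf{x}$ and $\mathbf{y}$ are, and then $G(\mathbf{x},\mathbf{y})=(G(\mathbf{x}),G(\mathbf{y}))$. $G$-compactness. A subset $A$ of $X$ (or of $X\times X$) is $G$-compact if every sequence of points in $A$ has a subsequence $\mathbf{y}$ with $G(\mathbf{y})=\ell\in A$. *)

(* Defs.v *)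
From HB Require Import structures.
From mathcomp Require Import all_boot all_order all_algebra.
From mathcomp Require Import all_classical.
From mathcomp Require Import topology sequences.

Set Implicit Arguments.
Unset Strict Implicit.
Unset Printing Implicit Defensive.

Local Open Scope classical_set_scope.
Local Open Scope group_scope.

(* The (possibly non-abelian) group underlying a group with operations is the
   library's [groupType].  The library writes groups multiplicatively, so that
   [x * y], [x^-1] and [1] below stand for x + y, - x and 0. *)

Inductive gwo_term (O1 O2 : Type) : Type :=
| TVar of nat
| TZero
| TAdd of gwo_term O1 O2 & gwo_term O1 O2
| TOpp of gwo_term O1 O2
| TOp1 of O1 & gwo_term O1 O2
| TOp2 of O2 & gwo_term O1 O2 & gwo_term O1 O2.

(* [gwo_op1] indexes Omega_1' (the unary operations other than -), [gwo_op2]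
   indexes Omega_2' (the binary operations other than +), and [gwo_dual] is
   the map taking a binary operation to the one with exchanged arguments.
   [gwo_identities] holds the identities of the category other than the group
   laws and the distributivity laws, which are imposed in
   [isGroupWithOperations]. *)
Record gwo_category : Type := GwoCategory {
  gwo_op1 : Type;
  gwo_op2 : Type;
  gwo_dual : gwo_op2 -> gwo_op2;
  gwo_identities : gwo_term gwo_op1 gwo_op2 -> gwo_term gwo_op1 gwo_op2 -> Prop
}.

Fixpoint gwo_eval (X : groupType) (O1 O2 : Type) (f1 : O1 -> X -> X)
    (f2 : O2 -> X -> X -> X) (v : nat -> X) (t : gwo_term O1 O2) : X :=
  match t with
  | TVar n => v n
  | TZero => 1
  | TAdd t1 t2 => gwo_eval f1 f2 v t1 * gwo_eval f1 f2 v t2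
  | TOpp t1 => (gwo_eval f1 f2 v t1)^-1
  | TOp1 w t1 => f1 w (gwo_eval f1 f2 v t1)
  | TOp2 s t1 t2 => f2 s (gwo_eval f1 f2 v t1) (gwo_eval f1 f2 v t2)
  end.

HB.mixin Record isGroupWithOperations (C : gwo_category) X of Group X := {
  op1 : gwo_op1 C -> X -> X;
  op2 : gwo_op2 C -> X -> X -> X;
  op2_dual : forall s x y, op2 (gwo_dual s) x y = op2 s y x;
  op2Dr : forall s x y z, op2 s x (y * z) = op2 s x y * op2 s x z;
  op1D : forall w x y, op1 w (x * y) = op1 w x * op1 w y;
  op2_op1 : forall w s x y, op2 s (op1 w x) y = op1 w (op2 s x y);
  op_identities : forall t1 t2, gwo_identities t1 t2 ->
    forall v : nat -> X, gwo_eval op1 op2 v t1 = gwo_eval op1 op2 v t2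
}.

#[short(type="gwoType")]
HB.structure Definition GroupWithOperations (C : gwo_category) :=
  {X of isGroupWithOperations C X & Group X}.

HB.mixin Record isTopologicalGwo (C : gwo_category) X
    of GroupWithOperations C X & Topological X := {
  add_continuous : continuous (fun xy : X * X => xy.1 * xy.2);
  opp_continuous : continuous (fun x : X => x^-1);
  op1_continuous : forall w : gwo_op1 C, continuous (fun x : X => op1 w x);
  op2_continuous : forall s : gwo_op2 C,
    continuous (fun xy : X * X => op2 s xy.1 xy.2)
}.

#[short(type="topologicalGwoType")]
HB.structure Definition TopologicalGwo (C : gwo_category) :=
  {X of isTopologicalGwo C X & GroupWithOperations C X & Topological X}.

Section SequenceGroup.
Variable X : groupType.
Implicit Types x y z : nat -> X.

Let mul x y : nat -> X := fun n => x n * y n.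
Let inv x : nat -> X := fun n => (x n)^-1.
Let one : nat -> X := fun=> 1.

Let mulA : associative mul.
Proof. by move=> x y z; apply/funext => n; exact: mulgA. Qed.
Let mul1 : left_id one mul.
Proof. by move=> x; apply/funext => n; exact: mul1g. Qed.
Let mulr1 : right_id one mul.
Proof. by move=> x; apply/funext => n; exact: mulg1. Qed.
Let mulV : left_inverse one inv mul.
Proof. by move=> x; apply/funext => n; exact: mulVg. Qed.
Let mulrV : right_inverse one inv mul.
Proof. by move=> x; apply/funext => n; exact: mulgV. Qed.

HB.instance Definition _ :=
  isGroup.Build (nat -> X) mulA mul1 mulr1 mulV mulrV.
End SequenceGroup.

Section SequenceGwo.
Variables (C : gwo_category) (X : gwoType C).
Implicit Types x y z : nat -> X.

Let sop1 (w : gwo_op1 C) x : nat -> X := fun n => op1 w (x n).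
Let sop2 (s : gwo_op2 C) x y : nat -> X := fun n => op2 s (x n) (y n).

Let sop2_dual s x y : sop2 (gwo_dual s) x y = sop2 s y x.
Proof. by apply/funext => n; exact: op2_dual. Qed.
Let sop2Dr s x y z : sop2 s x (y * z) = sop2 s x y * sop2 s x z.
Proof. by apply/funext => n; exact: op2Dr. Qed.
Let sop1D w x y : sop1 w (x * y) = sop1 w x * sop1 w y.
Proof. by apply/funext => n; exact: op1D. Qed.
Let sop2_op1 w s x y : sop2 s (sop1 w x) y = sop1 w (sop2 s x y).
Proof. by apply/funext => n; exact: op2_op1. Qed.

Let eval_seq (v : nat -> nat -> X) t n :
  gwo_eval sop1 sop2 v t n = gwo_eval op1 op2 (fun k => v k n) t.
Proof.
elim: t => [k||t1 e1 t2 e2|t e|w t e|s t1 e1 t2 e2] //=.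
- by rewrite -e1 -e2.
- by rewrite -e.
- by rewrite -e.
- by rewrite -e1 -e2.
Qed.

Let sidentities t1 t2 : gwo_identities t1 t2 ->
  forall v, gwo_eval sop1 sop2 v t1 = gwo_eval sop1 sop2 v t2.
Proof.
by move=> e v; apply/funext => n; rewrite !eval_seq; exact: op_identities.
Qed.

HB.instance Definition _ := isGroupWithOperations.Build C (nat -> X)
  sop2_dual sop2Dr sop1D sop2_op1 sidentities.
End SequenceGwo.

Section ProductGwo.
Variables (C : gwo_category) (X Y : gwoType C).
Implicit Types x y z : X * Y.

Let pop1 (w : gwo_op1 C) x : X * Y := (op1 w x.1, op1 w x.2).
Let pop2 (s : gwo_op2 C) x y : X * Y := (op2 s x.1 y.1, op2 s x.2 y.2).

Let pop2_dual s x y : pop2 (gwo_dual s) x y = pop2 s y x.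
Proof. by rewrite /pop2 !op2_dual. Qed.
Let pop2Dr s x y z : pop2 s x (y * z) = pop2 s x y * pop2 s x z.
Proof. by rewrite /pop2 /= !op2Dr. Qed.
Let pop1D w x y : pop1 w (x * y) = pop1 w x * pop1 w y.
Proof. by rewrite /pop1 /= !op1D. Qed.
Let pop2_op1 w s x y : pop2 s (pop1 w x) y = pop1 w (pop2 s x y).
Proof. by rewrite /pop1 /pop2 /= !op2_op1. Qed.

Let eval_pair (v : nat -> X * Y) t : gwo_eval pop1 pop2 v t =
  (gwo_eval op1 op2 (fst \o v) t, gwo_eval op1 op2 (snd \o v) t).
Proof.
elim: t => [k||t1 /= -> t2 ->|t /= ->|w t /= ->|s t1 /= -> t2 ->] //=.
by case: (v k).
Qed.

Let pidentities t1 t2 : gwo_identities t1 t2 ->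
  forall v, gwo_eval pop1 pop2 v t1 = gwo_eval pop1 pop2 v t2.
Proof.
by move=> e v; rewrite !eval_pair; congr pair; exact: op_identities.
Qed.

HB.instance Definition _ := isGroupWithOperations.Build C (X * Y)%type
  pop2_dual pop2Dr pop1D pop2_op1 pidentities.
End ProductGwo.

Section ProductTopologicalGwo.
Variables (C : gwo_category) (X Y : topologicalGwoType C).

Let pair_continuous (T U V : topologicalType) (f : T -> U) (g : T -> V) :
  continuous f -> continuous g -> continuous (fun t => (f t, g t)).
Proof. by move=> cf cg t; apply: cvg_pair; [exact: cf|exact: cg]. Qed.

Let comp2_continuous (T U : topologicalType) (f : U * U -> U) (p q : T -> U) :
  continuous f -> continuous p -> continuous q ->
  continuous (fun t => f (p t, q t)).
Proof.
by move=> cf cp cq t; apply: (@continuous_comp _ _ _ (fun t => (p t, q t)) f);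
  [exact: pair_continuous|exact: cf].
Qed.

Let fst_c (T U : topologicalType) : continuous (@fst T U).
Proof. by move=> t; exact: cvg_fst. Qed.
Let snd_c (T U : topologicalType) : continuous (@snd T U).
Proof. by move=> t; exact: cvg_snd. Qed.

Let comp_c (S T U : topologicalType) (f : S -> T) (g : T -> U) :
  continuous f -> continuous g -> continuous (g \o f).
Proof. by move=> cf cg t; apply: continuous_comp; [exact: cf|exact: cg]. Qed.

Let XY : topologicalType := (X * Y)%type.

Let padd_continuous :
  continuous (fun xy : (X * Y) * (X * Y) => xy.1 * xy.2).
Proof.
apply: (@pair_continuous _ X Y (fun xy : XY * XY => xy.1.1 * xy.2.1)
                               (fun xy : XY * XY => xy.1.2 * xy.2.2)).
- apply: (comp2_continuous (f := fun ab : X * X => ab.1 * ab.2)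
    (p := fun xy : XY * XY => xy.1.1) (q := fun xy : XY * XY => xy.2.1)).
  + exact: add_continuous.
  + exact: (comp_c (@fst_c XY XY) (@fst_c X Y)).
  + exact: (comp_c (@snd_c XY XY) (@fst_c X Y)).
- apply: (comp2_continuous (f := fun ab : Y * Y => ab.1 * ab.2)
    (p := fun xy : XY * XY => xy.1.2) (q := fun xy : XY * XY => xy.2.2)).
  + exact: add_continuous.
  + exact: (comp_c (@fst_c XY XY) (@snd_c X Y)).
  + exact: (comp_c (@snd_c XY XY) (@snd_c X Y)).
Qed.

Let popp_continuous : continuous (fun x : X * Y => x^-1).
Proof.
apply: (@pair_continuous _ X Y (fun x : XY => x.1^-1) (fun x : XY => x.2^-1)).
- exact: (comp_c (@fst_c X Y) (@opp_continuous C X)).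
- exact: (comp_c (@snd_c X Y) (@opp_continuous C Y)).
Qed.

Let pop1_continuous (w : gwo_op1 C) : continuous (fun x : X * Y => op1 w x).
Proof.
apply: (@pair_continuous _ X Y (fun x : XY => op1 w x.1)
                               (fun x : XY => op1 w x.2)).
- exact: (comp_c (@fst_c X Y) (@op1_continuous C X w)).
- exact: (comp_c (@snd_c X Y) (@op1_continuous C Y w)).
Qed.

Let pop2_continuous (s : gwo_op2 C) :
  continuous (fun xy : (X * Y) * (X * Y) => op2 s xy.1 xy.2).
Proof.
apply: (@pair_continuous _ X Y (fun xy : XY * XY => op2 s xy.1.1 xy.2.1)
                               (fun xy : XY * XY => op2 s xy.1.2 xy.2.2)).
- apply: (comp2_continuous (f := fun ab : X * X => op2 s ab.1 ab.2)
    (p := fun xy : XY * XY => xy.1.1) (q := fun xy : XY * XY => xy.2.1)).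
  + exact: op2_continuous.
  + exact: (comp_c (@fst_c XY XY) (@fst_c X Y)).
  + exact: (comp_c (@snd_c XY XY) (@fst_c X Y)).
- apply: (comp2_continuous (f := fun ab : Y * Y => op2 s ab.1 ab.2)
    (p := fun xy : XY * XY => xy.1.2) (q := fun xy : XY * XY => xy.2.2)).
  + exact: op2_continuous.
  + exact: (comp_c (@fst_c XY XY) (@snd_c X Y)).
  + exact: (comp_c (@snd_c XY XY) (@snd_c X Y)).
Qed.

HB.instance Definition _ := isTopologicalGwo.Build C (X * Y)%type
  padd_continuous popp_continuous pop1_continuous pop2_continuous.
End ProductTopologicalGwo.

Record is_subgwo (C : gwo_category) (X : gwoType C) (D : set X) : Prop := {
  subgwo0 : D 1;
  subgwoD : forall x y, D x -> D y -> D (x * y);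
  subgwoN : forall x, D x -> D x^-1;
  subgwo_op1 : forall (w : gwo_op1 C) x, D x -> D (op1 w x);
  subgwo_op2 : forall (s : gwo_op2 C) x y, D x -> D y -> D (op2 s x y)
}.

(* As for the library's [{morphism D >-> rT}], a morphism on the subobject [D]
   is a total function, the values of which outside [D] are irrelevant. *)
Record is_gwo_morphism_on (C : gwo_category) (X Y : gwoType C)
    (D : set X) (f : X -> Y) : Prop := {
  gwo_morphismD : forall x y, D x -> D y -> f (x * y) = f x * f y;
  gwo_morphism_op1 : forall (w : gwo_op1 C) x, D x -> f (op1 w x) = op1 w (f x);
  gwo_morphism_op2 : forall (s : gwo_op2 C) x y, D x -> D y ->
    f (op2 s x y) = op2 s (f x) (f y)
}.

Record Gmethod (C : gwo_category) (X : gwoType C) : Type := MkGmethod {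
  Gdom : set (nat -> X);
  Gfun : (nat -> X) -> X;
  Gdom_subgwo : is_subgwo Gdom;
  Gfun_morphism : is_gwo_morphism_on Gdom Gfun
}.

Definition G_converges (C : gwo_category) (X : gwoType C) (G : Gmethod X)
    (x : nat -> X) (l : X) : Prop :=
  Gdom G x /\ Gfun G x = l.

Definition G_regular (C : gwo_category) (X : topologicalGwoType C)
    (G : Gmethod X) : Prop :=
  forall (x : nat -> X) (l : X), x @ \oo --> l -> G_converges G x l.

Definition G_preserves_subsequences (C : gwo_category) (X : gwoType C)
    (G : Gmethod X) : Prop :=
  forall (x : nat -> X) (l : X), G_converges G x l ->
  forall phi : nat -> nat, increasing_seq phi -> G_converges G (x \o phi) l.

Definition G_compact (C : gwo_category) (X : gwoType C) (G : Gmethod X)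
    (A : set X) : Prop :=
  forall x : nat -> X, (forall n, A (x n)) ->
  exists2 phi : nat -> nat, increasing_seq phi &
  exists2 l : X, A l & G_converges G (x \o phi) l.

Section ProductMethod.
Variables (C : gwo_category) (X : gwoType C) (G : Gmethod X).

Definition Gprod_dom : set (nat -> X * X) :=
  [set z | Gdom G (fst \o z) /\ Gdom G (snd \o z)].

Definition Gprod_fun (z : nat -> X * X) : X * X :=
  (Gfun G (fst \o z), Gfun G (snd \o z)).

Lemma Gprod_dom_subgwo : is_subgwo Gprod_dom.
Proof.
have [d0 dD dN d1 d2] := Gdom_subgwo G; split.
- by split; exact: d0.
- by move=> x y [x1 x2] [y1 y2]; split; [exact: dD x1 y1|exact: dD x2 y2].
- by move=> x [x1 x2]; split; [exact: dN x1|exact: dN x2].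
- by move=> w x [x1 x2]; split; [exact: d1 x1|exact: d1 x2].
- by move=> s x y [x1 x2] [y1 y2]; split; [exact: d2 x1 y1|exact: d2 x2 y2].
Qed.

Lemma Gprod_fun_morphism : is_gwo_morphism_on Gprod_dom Gprod_fun.
Proof.
have [fD f1 f2] := Gfun_morphism G; split.
- by move=> x y [x1 x2] [y1 y2]; congr pair; [exact: fD x1 y1|exact: fD x2 y2].
- by move=> w x [x1 x2]; congr pair; [exact: f1 x1|exact: f1 x2].
- move=> s x y [x1 x2] [y1 y2].
  by congr pair; [exact: f2 x1 y1|exact: f2 x2 y2].
Qed.

Definition Gprod : Gmethod (X * X)%type :=
  MkGmethod Gprod_dom_subgwo Gprod_fun_morphism.
End ProductMethod.

(* Main.v *)
Require Import Defs.
From HB Require Import structures.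
From mathcomp Require Import all_boot all_order all_algebra.
From mathcomp Require Import all_classical.
From mathcomp Require Import topology sequences.

Local Open Scope classical_set_scope.

(** A sequence in [A `*` B] is a pair of sequences. The G-compactness of [A]
    gives a subsequence along which the first coordinate G-converges in [A];
    the G-compactness of [B], applied to the second coordinate along that
    subsequence, gives a further subsequence along which it G-converges in [B].
    The second extraction does not disturb the first coordinate, because G
    preserves the G-convergence of subsequences. *)

Lemma increasing_seq_comp (phi psi : nat -> nat) :
  increasing_seq phi -> increasing_seq psi -> increasing_seq (phi \o psi).
Proof. by move=> iphi ipsi m n; rewrite /= iphi; exact: ipsi. Qed.

Lemma Gprod_converges (C : gwo_category) (X : gwoType C) (G : Gmethod X)
    (z : nat -> X * X) (a b : X) :
  G_converges G (fst \o z) a -> G_converges G (snd \o z) b ->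
  G_converges (Gprod G) z (a, b).
Proof.
by move=> [da Ga] [db Gb]; split=> //=; rewrite /Gprod_fun Ga Gb.
Qed.

Theorem theorem3p1 (C : gwo_category) (X : topologicalGwoType C)
    (hX : hausdorff_space X) (G : Gmethod X)
    (hreg : G_regular G) (hsub : G_preserves_subsequences G)
    (A B : set X) (hA : G_compact G A) (hB : G_compact G B) :
  G_compact (Gprod G) (A `*` B).
Proof.
move=> z ABz.
have [phi iphi [a Aa za]] := hA (fst \o z) (fun n => (ABz n).1).
have [psi ipsi [b Bb zb]] := hB (snd \o z \o phi) (fun n => (ABz (phi n)).2).
exists (phi \o psi); first exact: increasing_seq_comp.
exists (a, b); first by [].
by apply: Gprod_converges; [exact: hsub za psi ipsi|exact: zb].
Qed.
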